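(* Let $A$ be a unital algebra over a field $k$ of characteristic not $2$, let $(\Omega^1,\mathrm{d})$ be an inner differential structure on $A$ with generator $\theta\in\Omega^1$ (i.e. $\mathrm{d}f=\theta f-f\theta$ for all $f\in A$), and let $\langle\ ,\ \rangle:\Omega^1\bar\otimes\Omega^1\to A$ be a bimodule map, where $\bar\otimes=\otimes_A$. (1) $\Delta f=2\langle\theta,\mathrm{d}f\rangle$, $f\in A$, defines a second order operator with bivector $\langle\ ,\ \rangle$, i.e. $$\Delta(fg)=(\Delta f)g+f\Delta g+2\langle\mathrm{d}f,\mathrm{d}g\rangle\qquad\text{for all } f,g\in A.$$ (2) The extended differential structure $(\tilde\Omega^1,\tilde{\mathrm{d}})$ defined by $(\Delta,\langle\ ,\ \rangle)$ is inner with the same generator $\theta$. (3) If $\sigma:\Omega^1\bar\otimes\Omega^1\to\Omega^1\bar\otimes\Omega^1$ and $(\ ,\ ):\Omega^1\bar\otimes\Omega^1\to A$ are bimodule maps such that $$[(\ ,\ )\sigma(\theta\bar\otimes\theta),f]=0\quad\text{for all } f\in A,\qquad \langle\ ,\ \rangle=\tfrac12(\ ,\ )(\mathrm{id}+\sigma),$$ then $(\ ,\ )\nabla\mathrm{d}=\Delta$ with $\Delta$ as in (1), where $\nabla\omega=\theta\bar\otimes\omega-\sigma(\omega\bar\otimes\theta)$ is the connection corresponding to $(\sigma,0)$. (4) In the situation of (3), $\Delta\omega=((\ ,\ )\otimes\mathrm{id})\nabla(\nabla\omega)$ for $\omega\in\Omega^1$ extends $\Delta$ to 1-forms such that $$\Delta(f\omega)=(\Delta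 f)\omega+f\Delta\omega+2\nabla_{\mathrm{d}f}\omega\qquad\text{for all } f\in A,\ \omega\in\Omega^1.$$ (5) Explicitly, in the situation of (3), for $\omega\in\Omega^1$, $$\Delta\omega=((\ ,\ )\otimes\mathrm{id})\left[\theta\bar\otimes\theta\bar\otimes\omega-(\sigma_{23}+\sigma_{12}\sigma_{23})(\theta\bar\otimes\omega\bar\otimes\theta)+\sigma_{12}\sigma_{23}\sigma_{12}(\omega\bar\otimes\theta\bar\otimes\theta)\right].$$ (6) In the situation of (3), if $\sigma(\theta\bar\otimes\theta)=\theta\bar\otimes\theta$ then $\Delta(f\theta)=(\Delta f)\theta$ for all $f\in A$ and $\Delta\theta=0$.
   Context: A differential structure on $A$ is an $A$-$A$-bimodule $\Omega^1$ with a linear map $\mathrm{d}:A\to\Omega^1$ satisfying $\mathrm{d}(fg)=(\mathrm{d}f)g+f\,\mathrm{d}g$ and such that $f\otimes g\mapsto f\,\mathrm{d}g$ is surjective onto $\Omega^1$. Extended differential structure of a second order operator $(\Delta,\langle\ ,\ \rangle)$, for a fixed parameter $\lambda\in k$: $\tilde\Omega^1=\Omega^1\oplus A\theta'$, where $A\theta'$ is a free rank one module on a symbol $\theta'$ commuting with $A$, with bimodule structure and derivation $\tilde{\mathrm{d}}$ (possibly without the surjectivity condition) $$[\theta',f]=0,\quad f\bullet\omega=f\omega,\quad \omega\bullet f=\omega f+\lambda\langle\omega,\mathrm{d}f\rangle\theta',\quad \tilde{\mathrm{d}}f=\mathrm{d}f+\tfrac{\lambda}{2}(\Delta f)\theta'$$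 for $f\in A$, $\omega\in\Omega^1$. Inner with generator $\theta$ means $\theta\bullet f-f\bullet\theta=\tilde{\mathrm{d}}f$ for all $f\in A$. $\nabla$ acts on $\Omega^1\bar\otimes\Omega^1$ by $\nabla\otimes\mathrm{id}+(\sigma\otimes\mathrm{id})(\mathrm{id}\otimes\nabla)$. $\nabla_\omega=(\langle\omega,\ \rangle\otimes\mathrm{id})\nabla$. $\sigma_{12},\sigma_{23}$ denote $\sigma$ acting in the indicated tensor factors of $\Omega^1\bar\otimes\Omega^1\bar\otimes\Omega^1$. *)

(* Defs.v *)
From HB Require Import structures.
From mathcomp Require Import all_boot all_order all_algebra.
From mathcomp Require Import boolp.

Set Implicit Arguments.
Unset Strict Implicit.
Unset Printing Implicit Defensive.

Import GRing.Theory.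
Local Open Scope ring_scope.
Local Open Scope quotient_scope.

Declare Scope bimodule_scope.
Delimit Scope bimodule_scope with BM.
Open Scope bimodule_scope.

(* Bimodules over a k-algebra A: a left A-module (the lmodType structure) with
   a commuting right A-action, on which the two induced k-actions agree. *)

HB.mixin Record Lmodule_isBimodule (k : fieldType) (A : algType k) M
    of GRing.Lmodule A M := {
  rscale : M -> A -> M;
  rscaleDl : forall (x y : M) (a : A), rscale (x + y) a = rscale x a + rscale y a;
  rscaleDr : forall (x : M) (a b : A), rscale x (a + b) = rscale x a + rscale x b;
  rscaleA : forall (x : M) (a b : A), rscale x (a * b) = rscale (rscale x a) b;
  rscale1 : forall x : M, rscale x 1 = x;
  scale_rscale : forall (a : A) (x : M) (b : A),
    rscale (a *: x) b = a *: rscale x b;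
  rscale_central : forall (c : k) (x : M), rscale x c%:A = c%:A *: x
}.

HB.structure Definition Bimodule (k : fieldType) (A : algType k) :=
  {M of GRing.Lmodule A M & Lmodule_isBimodule k A M}.

Notation bimodType A := (@Bimodule.type _ A).
Notation "x <*: a" := (rscale x a) (at level 40, left associativity)
  : bimodule_scope.

HB.mixin Record isRightScalable (k : fieldType) (A : algType k)
    (M N : bimodType A) (f : M -> N) := {
  rscalable_subproof : forall (x : M) (a : A), f (x <*: a) = f x <*: a
}.

HB.structure Definition Bimorphism (k : fieldType) (A : algType k)
    (M N : bimodType A) :=
  {f of isRightScalable k A M N f & @GRing.Linear A M N *:%R f}.

Arguments Bimorphism.type {k A} (M N)%_type_scope.
Notation "{ 'bimorph' M -> N }" := (Bimorphism.type M N)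
  (at level 0, M at level 98, N at level 99,
   format "{ 'bimorph'  M  ->  N }") : type_scope.

Lemma bimorphR (k : fieldType) (A : algType k) (M N : bimodType A)
  (f : {bimorph M -> N}) (x : M) (a : A) : f (x <*: a) = f x <*: a.
Proof. exact: rscalable_subproof. Qed.

Section BimoduleTheory.
Variables (k : fieldType) (A : algType k) (M : bimodType A).

Lemma rscale0l (a : A) : (0 : M) <*: a = 0.
Proof. by apply: (@addrI _ (0 <*: a)); rewrite -rscaleDl !addr0. Qed.

Lemma rscaleNl (x : M) (a : A) : (- x) <*: a = - (x <*: a).
Proof. by apply: (@addrI _ (x <*: a)); rewrite -rscaleDl !subrr rscale0l. Qed.

Lemma rscaleBl (x y : M) (a : A) : (x - y) <*: a = x <*: a - y <*: a.
Proof. by rewrite rscaleDl rscaleNl. Qed.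

End BimoduleTheory.

Section Regular.
Variables (k : fieldType) (A : algType k).

Fact regular_rscaleA (x a b : A) : x * (a * b) = x * a * b.
Proof. exact: mulrA. Qed.
Fact regular_scale_rscale (a x b : A) : a * x * b = a * (x * b).
Proof. by rewrite mulrA. Qed.
Fact regular_central (c : k) (x : A) : x * c%:A = c%:A * x.
Proof. by rewrite -scalerAr -scalerAl mulr1 mul1r. Qed.

HB.instance Definition _ := @Lmodule_isBimodule.Build k A A^o
  (fun x a : A => x * a) (fun x y a : A => mulrDl x y a)
  (fun x a b : A => mulrDr x a b) regular_rscaleA (@mulr1 A)
  regular_scale_rscale regular_central.

End Regular.

(* The tensor product M ⊗_A N. The list [:: (x1, y1); ..; (xn, yn)] stands for
   the formal sum x1 ⊗ y1 + .. + xn ⊗ yn; tensor_rel is the smallest congruence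
   of the free commutative monoid on M * N imposing biadditivity and
   xa ⊗ y = x ⊗ ay. The quotient is then a group, with - (x ⊗ y) = (- x) ⊗ y. *)

Section TensorDef.
Variables (k : fieldType) (A : algType k) (M N : bimodType A).

Inductive tensor_rel : seq (M * N) -> seq (M * N) -> Prop :=
| TensorRefl s : tensor_rel s s
| TensorSym s t : tensor_rel s t -> tensor_rel t s
| TensorTrans s t u : tensor_rel s t -> tensor_rel t u -> tensor_rel s u
| TensorCat s s' t t' :
    tensor_rel s s' -> tensor_rel t t' -> tensor_rel (s ++ t) (s' ++ t')
| TensorC s t : tensor_rel (s ++ t) (t ++ s)
| Tensor0l y : tensor_rel [:: (0, y)] [::]
| TensorDl x x' y : tensor_rel [:: (x + x', y)] [:: (x, y); (x', y)]
| TensorDr x y y' : tensor_rel [:: (x, y + y')] [:: (x, y); (x, y')]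
| TensorM x (a : A) y : tensor_rel [:: (x <*: a, y)] [:: (x, a *: y)].

Definition tensor_relb (s t : seq (M * N)) : bool := `[< tensor_rel s t >].

Fact tensor_relb_refl : reflexive tensor_relb.
Proof. by move=> s; apply/asboolP; exact: TensorRefl. Qed.

Fact tensor_relb_sym : symmetric tensor_relb.
Proof. by move=> s t; apply/asboolP/asboolP; exact: TensorSym. Qed.

Fact tensor_relb_trans : transitive tensor_relb.
Proof.
by move=> t s u /asboolP st /asboolP tu; apply/asboolP; exact: TensorTrans st tu.
Qed.

Canonical tensor_equiv :=
  EquivRel tensor_relb tensor_relb_refl tensor_relb_sym tensor_relb_trans.

Definition tensor := {eq_quot tensor_equiv}.
HB.instance Definition _ := Choice.on tensor.

Definition tensor_class (s : seq (M * N)) : tensor :=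
  \pi_({eq_quot tensor_equiv}) s.

Definition pure (x : M) (y : N) : tensor := tensor_class [:: (x, y)].

Lemma tensor_classP s t : tensor_class s = tensor_class t <-> tensor_rel s t.
Proof. by split=> [/eqquotP/asboolP|st] //; apply/eqquotP/asboolP. Qed.

Lemma tensor_class_repr (t : tensor) : tensor_class (repr t) = t.
Proof. exact: reprK. Qed.

Lemma repr_tensor_class s : tensor_rel (repr (tensor_class s)) s.
Proof. by apply/tensor_classP; exact: tensor_class_repr. Qed.

Definition tensor_add (s t : tensor) : tensor :=
  tensor_class (repr s ++ repr t).
Definition negl (p : M * N) : M * N := (- p.1, p.2).
Definition tensor_opp (t : tensor) : tensor := tensor_class (map negl (repr t)).
Definition tensor_zero : tensor := tensor_class [::].

Lemma tensor_add_class s t :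
  tensor_add (tensor_class s) (tensor_class t) = tensor_class (s ++ t).
Proof. by apply/tensor_classP; apply: TensorCat; exact: repr_tensor_class. Qed.

Fact tensor_addA : associative tensor_add.
Proof.
move=> s t u; rewrite -[s]tensor_class_repr -[t]tensor_class_repr.
by rewrite -[u]tensor_class_repr !tensor_add_class catA.
Qed.

Fact tensor_addC : commutative tensor_add.
Proof. by move=> s t; apply/tensor_classP; exact: TensorC. Qed.

Fact tensor_add0 : left_id tensor_zero tensor_add.
Proof. by move=> s; rewrite -[s]tensor_class_repr tensor_add_class. Qed.

Fact tensor_addN : left_inverse tensor_zero tensor_opp tensor_add.
Proof.
move=> t; rewrite -[X in tensor_add _ X]tensor_class_repr tensor_add_class.
apply/tensor_classP; elim: (repr t) => [|[x y] s IHs]; first exact: TensorRefl.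
have -> : map negl ((x, y) :: s) ++ (x, y) :: s
    = [:: (- x, y)] ++ (map negl s ++ [:: (x, y)] ++ s) by [].
apply: (@TensorTrans _ ([:: (- x, y)] ++ ([:: (x, y)] ++ (map negl s ++ s)))).
  apply: TensorCat; first exact: TensorRefl.
  by rewrite !catA; apply: TensorCat; [exact: TensorC | exact: TensorRefl].
apply: (@TensorCat [:: (- x, y); (x, y)] [::] _ [::]) => //.
apply: TensorTrans (Tensor0l y); rewrite -(addNr x).
exact: TensorSym (TensorDl (- x) x y).
Qed.

HB.instance Definition _ := GRing.isZmodule.Build tensor
  tensor_addA tensor_addC tensor_add0 tensor_addN.

Lemma tensor_classD s t :
  tensor_class (s ++ t) = tensor_class s + tensor_class t.
Proof. by rewrite -tensor_add_class. Qed.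

Lemma pureDl x x' y : pure (x + x') y = pure x y + pure x' y.
Proof. by rewrite -tensor_classD; apply/tensor_classP; exact: TensorDl. Qed.

Lemma pureDr x y y' : pure x (y + y') = pure x y + pure x y'.
Proof. by rewrite -tensor_classD; apply/tensor_classP; exact: TensorDr. Qed.

Lemma pureM x (a : A) y : pure (x <*: a) y = pure x (a *: y).
Proof. by apply/tensor_classP; exact: TensorM. Qed.

Lemma tensor_classE s : tensor_class s = \sum_(p <- s) pure p.1 p.2.
Proof.
elim: s => [|[x y] s IHs]; first by rewrite big_nil.
by rewrite big_cons -IHs -tensor_classD.
Qed.

Lemma tensor_ind (P : tensor -> Prop) :
  P 0 -> (forall x y t, P t -> P (pure x y + t)) -> forall t, P t.
Proof.
move=> P0 PS t; rewrite -[t]tensor_class_repr tensor_classE.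
by elim: (repr t) => [|p s IHs]; rewrite (big_nil, big_cons) //; exact: PS.
Qed.

Lemma tensor_ext (G : zmodType) (f g : tensor -> G) (t : tensor) :
  {morph f : x y / x + y} -> {morph g : x y / x + y} ->
  (forall x y, f (pure x y) = g (pure x y)) -> f t = g t.
Proof.
move=> fD gD fg; have morph0 (h : tensor -> G) : {morph h : x y / x + y} -> h 0 = 0.
  by move=> hD; apply: (@addrI _ (h 0)); rewrite -hD !addr0.
by elim/tensor_ind: t => [|x y t IH]; rewrite ?morph0 // fD gD fg IH.
Qed.

(* The universal property: balanced maps extend uniquely along pure. *)
Record balanced (G : zmodType) := Balanced {
  balanced_fun :> M -> N -> G;
  balancedDl : forall x x' y,
    balanced_fun (x + x') y = balanced_fun x y + balanced_fun x' y;
  balancedDr : forall x y y',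
    balanced_fun x (y + y') = balanced_fun x y + balanced_fun x y';
  balancedM : forall x (a : A) y,
    balanced_fun (x <*: a) y = balanced_fun x (a *: y)
}.

Definition tlift (G : zmodType) (b : balanced G) (t : tensor) : G :=
  \sum_(p <- repr t) b p.1 p.2.

Lemma balanced_sum (G : zmodType) (b : balanced G) s t : tensor_rel s t ->
  \sum_(p <- s) b p.1 p.2 = \sum_(p <- t) b p.1 p.2.
Proof.
elim=> {s t} //=.
- by move=> s t u _ -> _ ->.
- by move=> s s' t t' _ IHs _ IHt; rewrite !big_cat /= IHs IHt.
- by move=> s t; rewrite !big_cat /= addrC.
- move=> y; rewrite big_seq1 big_nil /=; apply: (@addrI _ (b 0 y)).
  by rewrite -balancedDl !addr0.
- by move=> x x' y; rewrite !big_cons !big_nil /= !addr0 balancedDl.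
- by move=> x y y'; rewrite !big_cons !big_nil /= !addr0 balancedDr.
- by move=> x a y; rewrite !big_seq1 balancedM.
Qed.

Lemma tlift_class (G : zmodType) (b : balanced G) s :
  tlift b (tensor_class s) = \sum_(p <- s) b p.1 p.2.
Proof. exact/balanced_sum/repr_tensor_class. Qed.

Lemma tliftE (G : zmodType) (b : balanced G) x y : tlift b (pure x y) = b x y.
Proof. by rewrite tlift_class big_seq1. Qed.

Lemma tliftD (G : zmodType) (b : balanced G) : {morph tlift b : s t / s + t}.
Proof.
move=> s t; rewrite -[s]tensor_class_repr -[t]tensor_class_repr -tensor_classD.
by rewrite !tlift_class big_cat.
Qed.

End TensorDef.

Arguments tensor {k A} (M N)%_type_scope.
Arguments balanced {k A} (M N)%_type_scope G%_type_scope.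
Notation "M ⊗ N" := (tensor M N) (at level 40, left associativity) : type_scope.
Notation "x ⊗ y" := (pure x y) (at level 40, left associativity)
  : bimodule_scope.

Local Obligation Tactic := idtac.

Ltac on_pure t :=
  pattern t; match goal with |- (fun x => @?l x = @?r x) t =>
    refine (@tensor_ext _ _ _ _ _ l r t _ _ _); move=> ? ? /= end.

Section TensorBimodule.
Variables (k : fieldType) (A : algType k) (M N : bimodType A).
Implicit Types (a b : A) (x : M) (y : N) (t : M ⊗ N).

Program Definition lact_bal a : balanced M N (M ⊗ N) :=
  @Balanced _ _ M N _ (fun x y => (a *: x) ⊗ y) _ _ _.
Next Obligation. by move=> * /=; rewrite scalerDr pureDl. Qed.
Next Obligation. by move=> * /=; rewrite pureDr. Qed.
Next Obligation. by move=> * /=; rewrite -scale_rscale pureM. Qed.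

Program Definition ract_bal a : balanced M N (M ⊗ N) :=
  @Balanced _ _ M N _ (fun x y => x ⊗ (y <*: a)) _ _ _.
Next Obligation. by move=> * /=; rewrite pureDl. Qed.
Next Obligation. by move=> * /=; rewrite rscaleDl pureDr. Qed.
Next Obligation. by move=> * /=; rewrite scale_rscale pureM. Qed.

Definition tensor_lact a t : M ⊗ N := tlift (lact_bal a) t.
Definition tensor_ract t a : M ⊗ N := tlift (ract_bal a) t.

Lemma tensor_lactE a x y : tensor_lact a (x ⊗ y) = (a *: x) ⊗ y.
Proof. exact: tliftE. Qed.
Lemma tensor_ractE a x y : tensor_ract (x ⊗ y) a = x ⊗ (y <*: a).
Proof. exact: tliftE. Qed.
Lemma tensor_lactD a : {morph tensor_lact a : s t / s + t}.
Proof. exact: tliftD. Qed.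
Lemma tensor_ractD a : {morph tensor_ract^~ a : s t / s + t}.
Proof. exact: tliftD. Qed.

Fact tensor_lactA a b t : tensor_lact a (tensor_lact b t) = tensor_lact (a * b) t.
Proof.
on_pure t; rewrite ?tensor_lactD //.
by rewrite !tensor_lactE scalerA.
Qed.

Fact tensor_lact1 : left_id 1 tensor_lact.
Proof.
move=> t; on_pure t; rewrite ?tensor_lactD //.
by rewrite tensor_lactE scale1r.
Qed.

Fact tensor_lactDl t : {morph tensor_lact^~ t : a b / a + b}.
Proof.
move=> a b; on_pure t.
- by rewrite tensor_lactD.
- by rewrite !tensor_lactD addrACA.
- by rewrite !tensor_lactE scalerDl pureDl.
Qed.

HB.instance Definition _ := GRing.Zmodule_isLmodule.Build A (tensor M N)
  tensor_lactA tensor_lact1 tensor_lactD tensor_lactDl.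

Lemma pureZl a x y : (a *: x) ⊗ y = a *: (x ⊗ y).
Proof. by rewrite -tensor_lactE. Qed.

Fact tensor_ractDl s t a : tensor_ract (s + t) a = tensor_ract s a + tensor_ract t a.
Proof. exact: tensor_ractD. Qed.

Fact tensor_ractDr t a b : tensor_ract t (a + b) = tensor_ract t a + tensor_ract t b.
Proof.
on_pure t.
- by rewrite tensor_ractD.
- by rewrite !tensor_ractD addrACA.
- by rewrite !tensor_ractE rscaleDr pureDr.
Qed.

Fact tensor_ractA t a b : tensor_ract t (a * b) = tensor_ract (tensor_ract t a) b.
Proof.
on_pure t; rewrite ?tensor_ractD //.
by rewrite !tensor_ractE rscaleA.
Qed.

Fact tensor_ract1 t : tensor_ract t 1 = t.
Proof.
on_pure t; rewrite ?tensor_ractD //.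
by rewrite tensor_ractE rscale1.
Qed.

Fact tensor_act_comm a t b : tensor_ract (a *: t) b = a *: tensor_ract t b.
Proof.
on_pure t; rewrite ?scalerDr ?tensor_ractD //.
  by rewrite scalerDr.
by rewrite -pureZl !tensor_ractE pureZl.
Qed.

Fact tensor_act_central (c : k) t : tensor_ract t c%:A = c%:A *: t.
Proof.
on_pure t; rewrite ?scalerDr ?tensor_ractD //.
by rewrite tensor_ractE rscale_central -pureM rscale_central pureZl.
Qed.

HB.instance Definition _ := Lmodule_isBimodule.Build k A (tensor M N)
  tensor_ractDl tensor_ractDr tensor_ractA tensor_ract1
  tensor_act_comm tensor_act_central.

Lemma pureZr a x y : x ⊗ (y <*: a) = (x ⊗ y) <*: a.
Proof. by rewrite -tensor_ractE. Qed.

Lemma pureBl x x' y : (x - x') ⊗ y = x ⊗ y - x' ⊗ y.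
Proof. by apply/eqP; rewrite eq_sym subr_eq -pureDl subrK. Qed.

Lemma pureBr x y y' : x ⊗ (y - y') = x ⊗ y - x ⊗ y'.
Proof. by apply/eqP; rewrite eq_sym subr_eq -pureDr subrK. Qed.

End TensorBimodule.

(* A balanced map compatible with both actions induces a bimodule map. *)
Section LiftBimorph.
Variables (k : fieldType) (A : algType k) (M N P : bimodType A).
Variable b : balanced M N P.

Definition tlift_bimod of
  (forall (a : A) x y, b (a *: x) y = a *: b x y) &
  (forall (a : A) x y, b x (y <*: a) = b x y <*: a) := tlift b.

Hypothesis bZl : forall (a : A) x y, b (a *: x) y = a *: b x y.
Hypothesis bZr : forall (a : A) x y, b x (y <*: a) = b x y <*: a.

Let f := tlift_bimod bZl bZr.

Fact tlift_bimod_linear : linear f.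
Proof.
move=> a s t; rewrite /f /tlift_bimod tliftD; congr (_ + _).
on_pure s.
- by rewrite scalerDr tliftD.
- by rewrite tliftD scalerDr.
- by rewrite -pureZl !tliftE bZl.
Qed.

Fact tlift_bimod_right t (a : A) : f (t <*: a) = f t <*: a.
Proof.
on_pure t; rewrite /f /tlift_bimod.
- by rewrite rscaleDl tliftD.
- by rewrite tliftD rscaleDl.
- by rewrite -pureZr !tliftE bZr.
Qed.

HB.instance Definition _ := @GRing.isLinear.Build A (tensor M N) P *:%R
  f tlift_bimod_linear.
HB.instance Definition _ := @isRightScalable.Build k A (tensor M N) P
  f tlift_bimod_right.

Definition tlift_bimorph : {bimorph M ⊗ N -> P} := f.

Lemma tlift_bimorphE x y : tlift_bimorph (x ⊗ y) = b x y.
Proof. exact: tliftE. Qed.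

End LiftBimorph.

Section Id.
Variables (k : fieldType) (A : algType k) (M : bimodType A).

Fact idfun_rscale (x : M) (a : A) : idfun (x <*: a) = idfun x <*: a.
Proof. by []. Qed.

HB.instance Definition _ := @isRightScalable.Build k A M M idfun idfun_rscale.

Definition bimid : {bimorph M -> M} := idfun.

End Id.

Section TensorMap.
Variables (k : fieldType) (A : algType k) (M M' N N' : bimodType A).
Variables (f : {bimorph M -> M'}) (g : {bimorph N -> N'}).

Program Definition tmap_bal : balanced M N (M' ⊗ N') :=
  @Balanced _ _ M N _ (fun x y => f x ⊗ g y) _ _ _.
Next Obligation. by move=> * /=; rewrite raddfD pureDl. Qed.
Next Obligation. by move=> * /=; rewrite raddfD pureDr. Qed.
Next Obligation. by move=> * /=; rewrite bimorphR linearZ pureM. Qed.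

Fact tmapZl (a : A) x y : tmap_bal (a *: x) y = a *: tmap_bal x y.
Proof. by rewrite /= linearZ pureZl. Qed.
Fact tmapZr (a : A) x y : tmap_bal x (y <*: a) = tmap_bal x y <*: a.
Proof. by rewrite /= bimorphR pureZr. Qed.

Definition tmap : {bimorph M ⊗ N -> M' ⊗ N'} := tlift_bimorph tmapZl tmapZr.

Lemma tmapE x y : tmap (x ⊗ y) = f x ⊗ g y.
Proof. exact: tlift_bimorphE. Qed.

End TensorMap.

(* The associativity isomorphism and its inverse. *)
Section Associator.
Variables (k : fieldType) (A : algType k) (M N P : bimodType A).

Program Definition assoc_bal0 (z : P) : balanced M N (M ⊗ (N ⊗ P)) :=
  @Balanced _ _ M N _ (fun x y => x ⊗ (y ⊗ z)) _ _ _.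
Next Obligation. by move=> * /=; rewrite pureDl. Qed.
Next Obligation. by move=> * /=; rewrite pureDl pureDr. Qed.
Next Obligation. by move=> * /=; rewrite pureM pureZl. Qed.

Program Definition assoc_bal : balanced (M ⊗ N) P (M ⊗ (N ⊗ P)) :=
  @Balanced _ _ (tensor M N) P _ (fun t z => tlift (assoc_bal0 z) t) _ _ _.
Next Obligation. by move=> * /=; rewrite tliftD. Qed.
Next Obligation.
move=> t z z' /=; on_pure t.
- by rewrite tliftD.
- by rewrite !tliftD addrACA.
- by rewrite !tliftE /= !pureDr.
Qed.
Next Obligation.
move=> t a z /=; on_pure t.
- by rewrite rscaleDl tliftD.
- by rewrite tliftD.
- by rewrite -pureZr !tliftE /= pureM.
Qed.

Fact assoc_balZl (a : A) t z : assoc_bal (a *: t) z = a *: assoc_bal t z.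
Proof.
rewrite /=; on_pure t.
- by rewrite scalerDr tliftD.
- by rewrite tliftD scalerDr.
- by rewrite -pureZl !tliftE /= pureZl.
Qed.
Fact assoc_balZr (a : A) t z : assoc_bal t (z <*: a) = assoc_bal t z <*: a.
Proof.
rewrite /=; on_pure t.
- by rewrite tliftD.
- by rewrite tliftD rscaleDl.
- by rewrite !tliftE /= !pureZr.
Qed.

Definition tassoc : {bimorph M ⊗ N ⊗ P -> M ⊗ (N ⊗ P)} :=
  tlift_bimorph assoc_balZl assoc_balZr.

Lemma tassocE x y z : tassoc (x ⊗ y ⊗ z) = x ⊗ (y ⊗ z).
Proof. by rewrite /tassoc tlift_bimorphE /= tliftE. Qed.

Program Definition assocV_bal0 (x : M) : balanced N P (M ⊗ N ⊗ P) :=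
  @Balanced _ _ N P _ (fun y z => x ⊗ y ⊗ z) _ _ _.
Next Obligation. by move=> * /=; rewrite pureDr pureDl. Qed.
Next Obligation. by move=> * /=; rewrite pureDr. Qed.
Next Obligation. by move=> * /=; rewrite pureZr pureM. Qed.

Program Definition assocV_bal : balanced M (N ⊗ P) (M ⊗ N ⊗ P) :=
  @Balanced _ _ M (tensor N P) _ (fun x t => tlift (assocV_bal0 x) t) _ _ _.
Next Obligation.
move=> x x' t /=; on_pure t.
- by rewrite tliftD.
- by rewrite !tliftD addrACA.
- by rewrite !tliftE /= !pureDl.
Qed.
Next Obligation. by move=> * /=; rewrite tliftD. Qed.
Next Obligation.
move=> x a t /=; on_pure t.
- by rewrite tliftD.
- by rewrite scalerDr tliftD.
- by rewrite -pureZl !tliftE /= pureM.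
Qed.

Fact assocV_balZl (a : A) x t : assocV_bal (a *: x) t = a *: assocV_bal x t.
Proof.
rewrite /=; on_pure t.
- by rewrite tliftD.
- by rewrite tliftD scalerDr.
- by rewrite !tliftE /= !pureZl.
Qed.
Fact assocV_balZr (a : A) x t : assocV_bal x (t <*: a) = assocV_bal x t <*: a.
Proof.
rewrite /=; on_pure t.
- by rewrite rscaleDl tliftD.
- by rewrite tliftD rscaleDl.
- by rewrite -pureZr !tliftE /= pureZr.
Qed.

Definition tassocV : {bimorph M ⊗ (N ⊗ P) -> M ⊗ N ⊗ P} :=
  tlift_bimorph assocV_balZl assocV_balZr.

Lemma tassocVE x y z : tassocV (x ⊗ (y ⊗ z)) = x ⊗ y ⊗ z.
Proof. by rewrite /tassocV tlift_bimorphE /= tliftE. Qed.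

Lemma tassocK : cancel tassoc tassocV.
Proof.
elim/tensor_ind => [|t z u IHu]; first by rewrite !raddf0.
rewrite !raddfD /= IHu; congr (_ + _); on_pure t.
- by rewrite pureDl !raddfD.
- by rewrite pureDl.
- by rewrite tassocE tassocVE.
Qed.

Lemma tassocVK : cancel tassocV tassoc.
Proof.
elim/tensor_ind => [|x t u IHu]; first by rewrite !raddf0.
rewrite !raddfD /= IHu; congr (_ + _); on_pure t.
- by rewrite pureDr !raddfD.
- by rewrite pureDr.
- by rewrite tassocVE tassocE.
Qed.

End Associator.

Section Contraction.
Variables (k : fieldType) (A : algType k).

(* p ⊗ id : M ⊗ P -> A ⊗ P followed by the identification A ⊗ P = P. *)
Section Contract.
Variables (M P : bimodType A) (p : {bimorph M -> A^o}).

Program Definition contract_bal : balanced M P P :=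
  @Balanced _ _ M P P (fun x z => (p x : A) *: z) _ _ _.
Next Obligation. by move=> * /=; rewrite raddfD scalerDl. Qed.
Next Obligation. by move=> * /=; rewrite scalerDr. Qed.
Next Obligation. by move=> * /=; rewrite bimorphR scalerA. Qed.

Fact contractZl (a : A) x z : contract_bal (a *: x) z = a *: contract_bal x z.
Proof. by rewrite /= linearZ /= scalerA. Qed.
Fact contractZr (a : A) x z : contract_bal x (z <*: a) = contract_bal x z <*: a.
Proof. by rewrite /= scale_rscale. Qed.

Definition contract : {bimorph M ⊗ P -> P} := tlift_bimorph contractZl contractZr.

Lemma contractE x z : contract (x ⊗ z) = (p x : A) *: z.
Proof. exact: tlift_bimorphE. Qed.

End Contract.

(* p(w, -) ⊗ id : N ⊗ P -> A ⊗ P = P; only a right module map. *)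
Section ContractAt.
Variables (M N P : bimodType A) (p : {bimorph M ⊗ N -> A^o}) (w : M).

Program Definition contract_at_bal : balanced N P P :=
  @Balanced _ _ N P P (fun y z => (p (w ⊗ y) : A) *: z) _ _ _.
Next Obligation. by move=> * /=; rewrite pureDr raddfD scalerDl. Qed.
Next Obligation. by move=> * /=; rewrite scalerDr. Qed.
Next Obligation. by move=> * /=; rewrite pureZr bimorphR scalerA. Qed.

Definition contract_at : N ⊗ P -> P := tlift contract_at_bal.

Lemma contract_atE y z : contract_at (y ⊗ z) = (p (w ⊗ y) : A) *: z.
Proof. exact: tliftE. Qed.

End ContractAt.
End Contraction.

(* sigma acting in two adjacent factors of (M ⊗ M) ⊗ M. *)
Section Braiding.
Variables (k : fieldType) (A : algType k) (M : bimodType A).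
Variable sigma : {bimorph M ⊗ M -> M ⊗ M}.

Definition sigma12 (t : M ⊗ M ⊗ M) : M ⊗ M ⊗ M := tmap sigma (bimid M) t.
Definition sigma23 (t : M ⊗ M ⊗ M) : M ⊗ M ⊗ M :=
  tassocV M M M (tmap (bimid M) sigma (tassoc M M M t)).

Lemma sigma12D : {morph sigma12 : s t / s + t}.
Proof. by move=> s t; rewrite /sigma12 raddfD. Qed.

Lemma sigma12R t (a : A) : sigma12 (t <*: a) = sigma12 t <*: a.
Proof. by rewrite /sigma12 bimorphR. Qed.

End Braiding.

Section Calculus.
Variables (k : fieldType) (A : algType k) (Om : bimodType A).

Definition is_derivation (d : A -> Om) : Prop :=
  [/\ forall f g, d (f + g) = d f + d g,
      forall (c : k) f, d (c *: f) = c%:A *: d f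
    & forall f g, d (f * g) = d f <*: g + f *: d g].

Record derivation := Derivation {
  derivation_fun :> A -> Om;
  derivationP : is_derivation derivation_fun
}.

Record differential_structure := DifferentialStructure {
  differential :> derivation;
  differential_surj : forall w : Om,
    exists s : seq (A * A), w = \sum_(p <- s) p.1 *: differential p.2
}.

Definition inner (d : A -> Om) (theta : Om) : Prop :=
  forall f, theta <*: f - f *: theta = d f.

Definition second_order_operator (d : derivation)
    (ip : {bimorph Om ⊗ Om -> A^o}) (Delta : A -> A) : Prop :=
  linear Delta /\
  forall f g, Delta (f * g)
    = Delta f * g + f * Delta g + (ip (d f ⊗ d g) : A) *+ 2.

End Calculus.

(* The extended bimodule Om ⊕ A θ', the pair (w, a) standing for w + a θ'. *)
Section Extended.
Variables (k : fieldType) (A : algType k) (Om : bimodType A).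
Variables (lambda : k) (d : derivation Om) (ip : {bimorph Om ⊗ Om -> A^o}).

Definition extended of k & derivation Om & {bimorph Om ⊗ Om -> A^o} : Type :=
  (Om * A^o)%type.

Local Notation ext := (extended lambda d ip).

HB.instance Definition _ := GRing.Lmodule.copy ext (Om * A^o)%type.

Definition ext_rscale (x : ext) (a : A) : ext :=
  (x.1 <*: a, (x.2 : A) * a + lambda *: (ip (x.1 ⊗ d a) : A)).

Let dD f g : d (f + g) = d f + d g.
Proof. by case: (derivationP d). Qed.
Let dZ (c : k) f : d (c *: f) = c%:A *: d f.
Proof. by case: (derivationP d). Qed.
Let dM f g : d (f * g) = d f <*: g + f *: d g.
Proof. by case: (derivationP d). Qed.
Let d1 : d 1 = 0.
Proof.
by apply: (@addrI _ (d 1)); rewrite addr0 -{3}[1]mulr1 dM rscale1 scale1r.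
Qed.

Fact ext_rscaleDl (x y : ext) (a : A) :
  ext_rscale (x + y) a = ext_rscale x a + ext_rscale y a.
Proof.
congr (_, _) => /=; first by rewrite rscaleDl.
by rewrite pureDl raddfD scalerDr mulrDl addrACA.
Qed.

Fact ext_rscaleDr (x : ext) (a b : A) :
  ext_rscale x (a + b) = ext_rscale x a + ext_rscale x b.
Proof.
congr (_, _) => /=; first by rewrite rscaleDr.
by rewrite dD pureDr raddfD scalerDr mulrDr addrACA.
Qed.

Fact ext_rscaleA (x : ext) (a b : A) :
  ext_rscale x (a * b) = ext_rscale (ext_rscale x a) b.
Proof.
congr (_, _) => /=; first by rewrite rscaleA.
rewrite dM pureDr raddfD /= pureZr bimorphR pureM scalerDr mulrDl -scalerAl.
by rewrite mulrA addrA.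
Qed.

Fact ext_rscale1 (x : ext) : ext_rscale x 1 = x.
Proof.
case: x => w a; congr (_, _) => /=; first by rewrite rscale1.
by rewrite d1 -(subrr (0 : Om)) pureBr subrr raddf0 scaler0 addr0 mulr1.
Qed.

Fact ext_scale_rscale (a : A) (x : ext) (b : A) :
  ext_rscale (a *: x) b = a *: ext_rscale x b.
Proof.
congr (_, _) => /=; first by rewrite scale_rscale.
rewrite pureZl linearZ; set p := ip _.
change (a * (x.2 : A) * b + lambda *: (a * (p : A))
  = a * ((x.2 : A) * b + lambda *: (p : A))).
by rewrite mulrDr mulrA scalerAr.
Qed.

Fact ext_rscale_central (c : k) (x : ext) : ext_rscale x c%:A = c%:A *: x.
Proof.
congr (_, _) => /=; first by rewrite rscale_central.
rewrite dZ d1 scaler0 -(subrr (0 : Om)) pureBr subrr raddf0 scaler0 addr0.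
exact: regular_central.
Qed.

HB.instance Definition _ := Lmodule_isBimodule.Build k A ext
  ext_rscaleDl ext_rscaleDr ext_rscaleA ext_rscale1
  ext_scale_rscale ext_rscale_central.

Definition ext_d (Delta : A -> A) (f : A) : ext :=
  (d f, (lambda / 2) *: Delta f).

End Extended.

Section Connections.
Variables (k : fieldType) (A : algType k) (Om : bimodType A).
Variable d : derivation Om.

Record bimodule_connection := BimoduleConnection {
  nabla :> Om -> Om ⊗ Om;
  braiding : {bimorph Om ⊗ Om -> Om ⊗ Om};
  nablaD : forall w e, nabla (w + e) = nabla w + nabla e;
  nabla_lact : forall (f : A) w, nabla (f *: w) = d f ⊗ w + f *: nabla w;
  nabla_ract : forall w (f : A),
    nabla (w <*: f) = nabla w <*: f + braiding (w ⊗ d f)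
}.

(* The action on Om ⊗ Om by nabla ⊗ id + (sigma ⊗ id)(id ⊗ nabla): only the
   sum of the two terms is balanced. *)
Section Square.
Variable D : bimodule_connection.

Program Definition nabla2_bal : balanced Om Om (Om ⊗ Om ⊗ Om) :=
  @Balanced _ _ Om Om _ (fun w e =>
    D w ⊗ e + sigma12 (braiding D) (tassocV Om Om Om (w ⊗ D e))) _ _ _.
Next Obligation.
move=> w w' e /=.
by rewrite nablaD !pureDl raddfD sigma12D addrACA.
Qed.
Next Obligation.
move=> w e e' /=.
by rewrite nablaD !pureDr raddfD sigma12D addrACA.
Qed.
Next Obligation.
move=> w a e /=.
rewrite nabla_ract nabla_lact pureDl pureDr (raddfD (tassocV Om Om Om)).
by rewrite sigma12D /= tassocVE !pureM {2}/sigma12 tmapE addrA.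
Qed.

Definition nabla2 : Om ⊗ Om -> Om ⊗ Om ⊗ Om := tlift nabla2_bal.

Lemma nabla2E w e : nabla2 (w ⊗ e)
  = D w ⊗ e + sigma12 (braiding D) (tassocV Om Om Om (w ⊗ D e)).
Proof. exact: tliftE. Qed.

(* nabla_w = (<w, - > ⊗ id) nabla *)
Definition covariant_derivative (ip : {bimorph Om ⊗ Om -> A^o}) (w e : Om) : Om :=
  contract_at ip w (D e).

(* ((,) ⊗ id) nabla nabla on 1-forms *)
Definition form_laplacian (m : {bimorph Om ⊗ Om -> A^o}) (w : Om) : Om :=
  contract Om m (nabla2 (D w)).

End Square.

Section Inner.
Variables (theta : Om) (d_inner : inner d theta).
Variable sigma : {bimorph Om ⊗ Om -> Om ⊗ Om}.

Definition inner_nabla (w : Om) : Om ⊗ Om := theta ⊗ w - sigma (w ⊗ theta).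

Fact inner_nablaD w e : inner_nabla (w + e) = inner_nabla w + inner_nabla e.
Proof. by rewrite /inner_nabla pureDl pureDr raddfD opprD addrACA. Qed.

Fact inner_nabla_lact (f : A) w :
  inner_nabla (f *: w) = d f ⊗ w + f *: inner_nabla w.
Proof.
rewrite /inner_nabla -d_inner pureBl !pureZl linearZ scalerBr addrA subrK.
by rewrite pureM.
Qed.

Fact inner_nabla_ract w (f : A) :
  inner_nabla (w <*: f) = inner_nabla w <*: f + sigma (w ⊗ d f).
Proof.
rewrite /inner_nabla -d_inner pureBr raddfB /= rscaleBl !pureZr bimorphR.
by rewrite addrA subrK pureM.
Qed.

(* The bimodule connection corresponding to (sigma, 0). *)
Definition inner_connection : bimodule_connection :=
  BimoduleConnection inner_nablaD inner_nabla_lact inner_nabla_ract.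

End Inner.
End Connections.

(* Main.v *)
Require Import Defs.
From mathcomp Require Import all_boot all_order all_algebra.

Set Implicit Arguments.
Unset Strict Implicit.
Unset Printing Implicit Defensive.

Import GRing.Theory.
Local Open Scope ring_scope.
Local Open Scope bimodule_scope.

(** The differential is the commutator with [theta], so every commutator of
    [theta] with a function in a tensor product over [A] can be read as a
    derivative.

    For functions: moving [f] across [theta] in [2 <theta, d (f g)>] leaves
    [2 <d f, d g>] behind, so the operator is of second order
    ([inner_second_order_operator]). The commutator with [(theta, 0)] in the
    extended bimodule has second component [lambda <theta, d f>], so it is the
    extended differential ([inner_extended]); being a commutator, that is a
    derivation ([inner_is_derivation]). Contracting
    [D (d f) = theta ⊗ d f - sigma (d f ⊗ theta)] with [m] gives
    [m (id + sigma) (theta ⊗ d f)], because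
    [m (sigma (theta ⊗ d f + d f ⊗ theta))] is the commutator of
    [m (sigma (theta ⊗ theta))] with [f], which is zero by hypothesis
    ([inner_laplacian_function]).

    For 1-forms, the Leibniz rule is a property of general bimodule connections
    ([form_laplacian_lact]): the cross term [d f ⊗ D w] occurs once plainly and
    once braided, and [m (id + sigma)] is twice the bivector. The explicit
    formula comes from computing the square of the connection once and for all
    as [t |-> theta ⊗ t - sigma12 (sigma23 (t ⊗ theta))] ([inner_nabla2E]), to be
    applied to [t = theta ⊗ w - sigma (w ⊗ theta)]. Finally, if [sigma] fixes
    [theta ⊗ theta] then [D theta = 0], and the values on multiples of [theta]
    follow from the Leibniz rule. *)

Lemma tlift0 (k : fieldType) (A : algType k) (M N : bimodType A) (G : zmodType)
  (b : balanced M N G) : tlift b 0 = 0.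
Proof. by apply: (@addrI _ (tlift b 0)); rewrite -tliftD !addr0. Qed.

Section InnerDerivation.
Variables (k : fieldType) (A : algType k) (M : bimodType A).

(** The commutator with a fixed element is a derivation of any bimodule;
    [k]-linearity holds because scalars act centrally. Applied to the extended
    bimodule, this spares checking the Leibniz rule of the extended
    differential by hand. *)
Lemma inner_is_derivation (d : A -> M) (theta : M) :
  inner d theta -> is_derivation d.
Proof.
move=> d_inner; split=> [f g|c f|f g]; rewrite -!d_inner.
- by rewrite rscaleDr scalerDl opprD addrACA.
- have -> : c *: f = c%:A * f by rewrite mulr_algl.
  rewrite rscaleA rscale_central scale_rscale -scalerA.
  by rewrite scalerBr.
- rewrite rscaleBl scalerBr rscaleA !scale_rscale scalerA.
  by rewrite addrA subrK.
Qed.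

Lemma inner_rscale (d : A -> M) (theta : M) (f : A) :
  inner d theta -> theta <*: f = d f + f *: theta.
Proof. by move=> <-; rewrite subrK. Qed.

End InnerDerivation.

Section Laplacian.
Variables (k : fieldType) (A : algType k) (Om : bimodType A).
Variables (d : derivation Om) (D : bimodule_connection d).

Lemma nabla2D : {morph nabla2 D : s t / s + t}.
Proof. exact: tliftD. Qed.

(** The left Leibniz rule passes to two-tensors because, in
    [nabla ⊗ id + (sigma ⊗ id)(id ⊗ nabla)], only the first summand
    differentiates [f], and it puts [d f] in the leftmost slot without
    braiding it with anything. *)
Lemma nabla2_lact (f : A) (t : Om ⊗ Om) :
  nabla2 D (f *: t) = tassocV Om Om Om (d f ⊗ t) + f *: nabla2 D t.
Proof.
on_pure t.
- by rewrite scalerDr nabla2D.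
- by rewrite nabla2D pureDr raddfD scalerDr /= addrACA.
- rewrite -pureZl !nabla2E nabla_lact tassocVE pureDl !pureZl.
  by rewrite linearZ /sigma12 linearZ scalerDr addrA.
Qed.

(** This is how the bivector enters the Laplacian: the pairing [m] meets [w]
    once directly and once through the braiding, and the two occurrences add up
    to [m (id + sigma)], which is twice the bivector. *)
Lemma contract_symmetrized (ip m : {bimorph Om ⊗ Om -> A^o})
    (sigma : {bimorph Om ⊗ Om -> Om ⊗ Om}) (w : Om) (t : Om ⊗ Om) :
  (forall u : Om ⊗ Om, (ip u : A) *+ 2 = m (u + sigma u)) ->
  contract Om m (tassocV Om Om Om (w ⊗ t))
    + contract Om m (sigma12 sigma (tassocV Om Om Om (w ⊗ t)))
  = contract_at ip w t *+ 2.
Proof.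
move=> ip2; on_pure t.
- by rewrite pureDr !raddfD /= sigma12D raddfD /= addrACA.
- by rewrite /contract_at tliftD mulrnDl.
- rewrite tassocVE /sigma12 tmapE !contractE contract_atE scalerMnl ip2.
  by rewrite raddfD scalerDl.
Qed.

(** The Leibniz rule of the Laplacian holds for every bimodule connection whose
    pairing symmetrizes to the bivector. Differentiating
    [f *: w] twice produces [D (d f) ⊗ w], [f] times the second derivative, and
    [d f ⊗ D w] twice, once braided. *)
Lemma form_laplacian_lact (ip m : {bimorph Om ⊗ Om -> A^o}) (f : A) (w : Om) :
  (forall t : Om ⊗ Om, (ip t : A) *+ 2 = m (t + braiding D t)) ->
  form_laplacian D m (f *: w)
  = (m (D (d f)) : A) *: w + f *: form_laplacian D m w
    + covariant_derivative D ip (d f) w *+ 2.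
Proof.
move=> ip2; rewrite /form_laplacian nabla_lact.
rewrite nabla2D nabla2E nabla2_lact !raddfD /= linearZ /= contractE.
rewrite -(contract_symmetrized _ _ ip2).
by rewrite -!addrA; congr (_ + _); rewrite addrCA addrA addrC addrA.
Qed.

End Laplacian.

Section BraidingAdditive.
Variables (k : fieldType) (A : algType k) (M : bimodType A).
Variable sigma : {bimorph M ⊗ M -> M ⊗ M}.

Lemma sigma23D : {morph sigma23 sigma : s t / s + t}.
Proof. by move=> s t; rewrite /sigma23 !raddfD. Qed.

Lemma sigma12B : {morph sigma12 sigma : s t / s - t}.
Proof. by move=> s t; rewrite /sigma12 raddfB. Qed.

Lemma sigma23B : {morph sigma23 sigma : s t / s - t}.
Proof. by move=> s t; rewrite /sigma23 !raddfB. Qed.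

End BraidingAdditive.

Section InnerConnection.
Variables (k : fieldType) (A : algType k) (Om : bimodType A).
Variables (d : derivation Om) (theta : Om) (d_inner : inner d theta).

(** In [2 <theta, d f g + f d g>] the element [f] is moved to the left of [theta]
    through the balanced tensor; its commutator with [theta] is [d f], and this
    is the bivector term. *)
Lemma inner_second_order_operator (ip : {bimorph Om ⊗ Om -> A^o}) :
  second_order_operator d ip (fun f => (ip (theta ⊗ d f) : A) *+ 2).
Proof.
have [dD dZ dM] := derivationP d; split=> [c f g|f g].
  rewrite dD dZ pureDr -rscale_central pureZr raddfD /= bimorphR mulrnDl.
  by rewrite -scalerMnr; congr (_ *+ 2 + _); apply: mulr_algr.
rewrite dM pureDr pureZr -pureM (inner_rscale _ d_inner) pureDl pureZl.
rewrite !raddfD /= bimorphR linearZ !mulrnDl.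
by rewrite mulrnAl mulrnAr [LHS]addrA [LHS]addrAC.
Qed.

(** In the second component, [theta • f] contributes [lambda <theta, d f>], while
    the extended differential has [lambda / 2] times [2 <theta, d f>]. *)
Lemma inner_extended (ip : {bimorph Om ⊗ Om -> A^o}) (lambda : k) :
  2%:R != 0 :> k ->
  inner (ext_d lambda d ip (fun f => (ip (theta ⊗ d f) : A) *+ 2))
        ((theta, 0) : extended lambda d ip).
Proof.
move=> two_neq0 f; congr (_, _) => /=; first exact: d_inner.
rewrite mul0r add0r scaler0 subr0 -scaler_nat scalerA.
by rewrite divfK.
Qed.

Variable sigma : {bimorph Om ⊗ Om -> Om ⊗ Om}.
Local Notation D := (inner_connection d_inner sigma).

(** On [x ⊗ y] the term [- sigma (x ⊗ theta) ⊗ y] from differentiating [x] is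
    cancelled by the [theta]-on-the-left term from differentiating [y], once
    braided. What remains has the shape of [inner_nabla] itself, with
    [sigma12 sigma23] as the braiding of a two-tensor past [theta]. *)
Lemma inner_nabla2E (t : Om ⊗ Om) :
  nabla2 D t = tassocV Om Om Om (theta ⊗ t)
               - sigma12 sigma (sigma23 sigma (t ⊗ theta)).
Proof.
on_pure t.
- exact: nabla2D.
- by rewrite pureDr pureDl sigma23D sigma12D raddfD /= opprD addrACA.
- rewrite nabla2E /= /inner_nabla pureBl pureBr !raddfB /=.
  rewrite /sigma12 raddfB /= !tassocVE tmapE /= addrA subrK.
  by rewrite /sigma23 tassocE tmapE.
Qed.

Lemma inner_laplacian_form (m : {bimorph Om ⊗ Om -> A^o}) (w : Om) :
  form_laplacian D m w
  = contract Om m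
      (theta ⊗ theta ⊗ w
       - (sigma23 sigma (theta ⊗ w ⊗ theta)
          + sigma12 sigma (sigma23 sigma (theta ⊗ w ⊗ theta)))
       + sigma12 sigma (sigma23 sigma (sigma12 sigma (w ⊗ theta ⊗ theta)))).
Proof.
rewrite /form_laplacian inner_nabla2E; congr (contract _ _ _).
rewrite /= /inner_nabla pureBr pureBl raddfB /= tassocVE.
have -> : tassocV Om Om Om (theta ⊗ sigma (w ⊗ theta))
  = sigma23 sigma (theta ⊗ w ⊗ theta) by rewrite /sigma23 tassocE tmapE.
have -> : sigma (w ⊗ theta) ⊗ theta = sigma12 sigma (w ⊗ theta ⊗ theta).
  by rewrite /sigma12 tmapE.
by rewrite sigma23B sigma12B opprB opprD !addrA addrAC.
Qed.

(** As [d f] is a commutator with [theta], the sum [theta ⊗ d f + d f ⊗ theta]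
    telescopes to [(theta ⊗ theta) <*: f - f *: (theta ⊗ theta)]; its image under
    [m sigma] vanishes as soon as [m (sigma (theta ⊗ theta))] commutes with
    [f], which trades [- m (sigma (d f ⊗ theta))] for
    [m (sigma (theta ⊗ d f))]. *)
Lemma inner_laplacian_function (m : {bimorph Om ⊗ Om -> A^o}) (f : A) :
  (m (sigma (theta ⊗ theta)) : A) * f = f * (m (sigma (theta ⊗ theta)) : A) ->
  m (D (d f)) = m (theta ⊗ d f + sigma (theta ⊗ d f)).
Proof.
move=> comm; rewrite /= /inner_nabla raddfB raddfD; congr (_ + _).
apply/eqP; rewrite eq_sym -addr_eq0 -!raddfD /= -d_inner.
rewrite pureBl pureBr pureM addrA subrK raddfB /= pureZr pureZl.
rewrite bimorphR linearZ raddfB /= bimorphR linearZ subr_eq0.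
exact/eqP.
Qed.

End InnerConnection.

Theorem proposition4p3 (k : fieldType) (k_char : 2%N \notin [pchar k])
    (A : algType k) (Om : bimodType A) (d : differential_structure Om)
    (theta : Om) (d_inner : inner d theta)
    (ip : {bimorph Om ⊗ Om -> A^o}) :
  let Delta : A -> A := fun f => (ip (theta ⊗ d f) : A) *+ 2 in
  (* (1) *)
  second_order_operator d ip Delta /\
  (* (2) *)
  (forall lambda : k,
    is_derivation (ext_d lambda d ip Delta) /\
    inner (ext_d lambda d ip Delta) ((theta, 0) : extended lambda d ip)) /\
  (forall (sigma : {bimorph Om ⊗ Om -> Om ⊗ Om})
      (m : {bimorph Om ⊗ Om -> A^o}),
    (forall f : A, (m (sigma (theta ⊗ theta)) : A) * f
                   - f * (m (sigma (theta ⊗ theta)) : A) = 0) ->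
    (forall t : Om ⊗ Om, (ip t : A) = (2^-1 : k) *: (m (t + sigma t) : A)) ->
    let D : bimodule_connection d := inner_connection d_inner sigma in
    let Delta1 : Om -> Om := form_laplacian D m in
    [/\ (* (3) *)
        forall f : A, (m (D (d f)) : A) = Delta f,
        (* (4) *)
        forall (f : A) (w : Om),
          Delta1 (f *: w) = Delta f *: w + f *: Delta1 w
                            + covariant_derivative D ip (d f) w *+ 2,
        (* (5) *)
        forall w : Om,
          Delta1 w = contract Om m
            (theta ⊗ theta ⊗ w
             - (sigma23 sigma (theta ⊗ w ⊗ theta)
                + sigma12 sigma (sigma23 sigma (theta ⊗ w ⊗ theta)))
             + sigma12 sigma (sigma23 sigma (sigma12 sigma (w ⊗ theta ⊗ theta))))
      & (* (6) *)
        sigma (theta ⊗ theta) = theta ⊗ theta ->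
        (forall f : A, Delta1 (f *: theta) = Delta f *: theta) /\
        Delta1 theta = 0]).
Proof.
have two_neq0 : 2%:R != 0 :> k by move: k_char; rewrite inE.
move=> Delta; split; first exact: inner_second_order_operator.
split=> [lambda|sigma m comm ipE D Delta1].
  have inn := inner_extended d_inner ip lambda two_neq0.
  by split; [exact: inner_is_derivation inn | exact: inn].
have ip2 (t : Om ⊗ Om) : (ip t : A) *+ 2 = m (t + sigma t).
  by rewrite ipE -scaler_nat scalerA divff // scale1r.
have DdE f : m (D (d f)) = Delta f.
  rewrite /Delta ip2; apply: inner_laplacian_function.
  by apply/eqP; rewrite -subr_eq0 comm.
have Delta1_lact f w : Delta1 (f *: w)
    = Delta f *: w + f *: Delta1 w + covariant_derivative D ip (d f) w *+ 2.
  by rewrite /Delta1 (@form_laplacian_lact _ _ _ _ D ip m f w ip2) DdE.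
split=> // [w|sigma_theta]; first exact: inner_laplacian_form.
have Dtheta : D theta = 0 by rewrite /= /inner_nabla sigma_theta subrr.
have Delta1_theta : Delta1 theta = 0.
  by rewrite /Delta1 /form_laplacian Dtheta /nabla2 tlift0 raddf0.
split=> // f.
rewrite Delta1_lact Delta1_theta /covariant_derivative Dtheta.
by rewrite /contract_at tlift0 scaler0 mul0rn !addr0.
Qed.
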